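(* Let $p\ge 1$, $1\le r\le p$, and let $S=(s_{ij})\in\mathbb{R}^{p\times p}$ be a symmetric positive semidefinite matrix with strictly positive diagonal entries. For $\phi=(\phi_1,\dots,\phi_p)>0$ (componentwise) let $\Phi=\mathrm{diag}(\phi_1,\dots,\phi_p)$, let $\lambda_1^*\ge\dots\ge\lambda_p^*$ be the eigenvalues of $\Phi^{1/2}S\Phi^{1/2}$, and let $$f(\phi)=\sum_{i=1}^p(-\log\phi_i+s_{ii}\phi_i)+\sum_{i=1}^r\big(\log(\max\{1,\lambda_i^*\})-\max\{1,\lambda_i^*\}+1\big).$$ Then on $\{\phi>0\}$ the function $f$ is the difference of two convex functions: $f(\phi)=f_1(\phi)-f_2(\phi)$, where $$f_1(\phi)=\sum_{i=1}^p(-\log\phi_i+s_{ii}\phi_i),\qquad f_2(\phi)=-\sum_{i=1}^r\big(\log(\max\{1,\lambda_i^*\})-\max\{1,\lambda_i^*\}+1\big)$$ are both convex functions of $\phi$ on $\{\phi>0\}$. *)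

(* Defs.v *)
From mathcomp Require Import all_boot all_order all_algebra.
From mathcomp Require Import polyrcf complex.
From mathcomp Require Import all_classical all_reals all_analysis.

Set Implicit Arguments.
Unset Strict Implicit.
Unset Printing Implicit Defensive.

Import Order.TTheory GRing.Theory Num.Theory.

Local Open Scope classical_set_scope.
Local Open Scope ring_scope.

Section FactorObjective.
Variable R : realType.

Definition psd n (A : 'M[R]_n) : Prop :=
  forall x : 'cV[R]_n, 0 <= (x^T *m A *m x) 0 0.

(* Real eigenvalues in nonincreasing order, repeated according to their
   algebraic multiplicity; when A is symmetric this list has length n. *)
Definition eigvals n (A : 'M[R]_n) : seq R :=
  sort >=%R (flatten [seq nseq (mup x (char_poly A)) x
                     | x <- rootsR (char_poly A)]).

Lemma sym_char_poly_split n (A : 'M[R]_n) : A^T = A ->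
  exists s : seq R, char_poly A = \prod_(x <- s) ('X - x%:P).
Proof.
move=> Asym; pose B := map_mx (real_complex R) A.
have Bherm : B \is hermsymmx.
  apply: realsym_hermsym.
    apply/is_hermitianmxP; rewrite expr0 scale1r map_mx_id//.
    by rewrite /B map_trmx Asym.
  by apply/mxOverP => i j; rewrite mxE ; apply/complex_realP; exists (A i j).
have /orthomx_spectralP BE := hermitian_normalmx Bherm.
have /mxOverP Dreal := hermitian_spectral_diag_real Bherm.
set D := spectral_diag B in BE Dreal.
exists [seq complex.Re (D 0 i) | i <- enum 'I_n].
apply: (map_poly_inj (real_complex R)); rewrite map_char_poly -/B.
rewrite rmorph_prod big_map big_enum/=.
have -> : char_poly B = char_poly (diag_mx D).
  pose P := map_mx (@polyC _) (spectralmx B).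
  have Pu : P \in unitmx by rewrite unitmxE det_map_mx rmorph_unit// -unitmxE spectral_unit.
  rewrite /char_poly [in LHS]BE.
  have -> : char_poly_mx (invmx (spectralmx B) *m diag_mx D *m spectralmx B) =
      invmx P *m char_poly_mx (diag_mx D) *m P.
    rewrite /char_poly_mx !map_mxM/= -/P map_invmx -/P mulmxBr mulmxBl.
    by rewrite scalar_mxC mulmxKV.
  by rewrite !det_mulmx det_inv mulrAC mulVr ?mul1r// -unitmxE.
rewrite char_poly_trig ?diag_mx_is_trig//.
apply: eq_bigr => i _; rewrite !mxE eqxx mulr1n rmorphB/= map_polyX map_polyC/=.
by rewrite RRe_real ?Dreal.
Qed.

Lemma eigvals_sorted n (A : 'M[R]_n) : sorted >=%R (eigvals A).
Proof. by apply: sort_sorted => x y; exact: le_total. Qed.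

Lemma sym_char_polyE n (A : 'M[R]_n) : A^T = A ->
  char_poly A = \prod_(x <- eigvals A) ('X - x%:P).
Proof.
move=> /sym_char_poly_split[s sE]; rewrite [LHS]sE; apply: perm_big.
have pn0 : char_poly A != 0 by rewrite monic_neq0 ?char_poly_monic.
rewrite perm_sym /eigvals (perm_trans (permEl (perm_sort _ _)))//.
apply/allP => x _ /=; apply/eqP.
rewrite -(mu_prod_XsubC x s) -sE count_flatten -map_comp sumnE big_map.
have [xr|xr] := boolP (x \in rootsR (char_poly A)); last first.
  rewrite mupNroot; last first.
    by have := roots_on_rootsR pn0 x; rewrite in_itv/= (negPf xr) => ->.
  rewrite big1_seq// => y /andP[_ yr] /=.
  by rewrite count_nseq/=; case: eqP => // yx; rewrite -yx yr in xr.
rewrite (bigD1_seq x) ?uniq_roots//= count_nseq /= eqxx mul1n big1 ?addn0//.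
by move=> y yx; rewrite count_nseq/= (negPf yx).
Qed.

Lemma size_eigvals n (A : 'M[R]_n) : A^T = A -> size (eigvals A) = n.
Proof.
by move=> /sym_char_polyE/(congr1 (size \o val)) /=;
  rewrite size_char_poly size_prod_XsubC => -[].
Qed.

Variables (p r : nat) (S : 'M[R]_p).
Implicit Type phi : 'rV[R]_p.

Definition pos_orthant : set 'rV[R]_p := [set phi | forall i, 0 < phi 0 i].

Definition sqrt_diag phi : 'M[R]_p := diag_mx (map_mx Num.sqrt phi).

Definition scaled phi : 'M[R]_p := sqrt_diag phi *m S *m sqrt_diag phi.

(* eigstar phi i is the (i+1)-st largest eigenvalue *)
Definition eigstar phi (i : nat) : R := (eigvals (scaled phi))`_i.

Definition f phi : R :=
  \sum_(i < p) (- ln (phi 0 i) + S i i * phi 0 i) +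
  \sum_(i < r) (ln (Num.max 1 (eigstar phi i))
                - Num.max 1 (eigstar phi i) + 1).

Definition f1 phi : R := \sum_(i < p) (- ln (phi 0 i) + S i i * phi 0 i).

Definition f2 phi : R :=
  - \sum_(i < r) (ln (Num.max 1 (eigstar phi i))
                  - Num.max 1 (eigstar phi i) + 1).

End FactorObjective.

Arguments pos_orthant : clear implicits.

(* Main.v *)
(* Only the convexity of f2 is substantial. Write S = K^* K with K complex; then
   Phi^(1/2) S Phi^(1/2) has the same characteristic polynomial as
   M(phi) = K Phi K^*, which is linear in phi, and f2 is the sum of g over the r
   largest eigenvalues of M(phi), where g x = max(1, x) - ln (max(1, x)) - 1 is
   convex and nondecreasing. In an orthonormal eigenbasis (u_i) of M(z), with z
   between x and y, each eigenvalue of M(z) is the corresponding convex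
   combination of u_i^* M(x) u_i and u_i^* M(y) u_i. For any orthonormal basis,
   u_i^* M u_i = sum_j w_ij lambda_j(M) with w doubly stochastic, so Jensen and
   the monotonicity of j |-> g (lambda_j(M)) give
   sum_(i < r) g (u_i^* M u_i) <= sum_(i < r) g (lambda_i(M)). *)
Require Import Defs.
From mathcomp Require Import all_boot all_order all_algebra.
From mathcomp Require Import perm ring lra polyrcf complex.
From mathcomp Require Import all_classical all_reals all_analysis.

Set Implicit Arguments.
Unset Strict Implicit.
Unset Printing Implicit Defensive.

Import Order.TTheory GRing.Theory Num.Theory.
Local Open Scope ring_scope.

(** * Swapping factors in a characteristic polynomial; doubly stochastic sums *)

Lemma char_poly_mulC (K : idomainType) (n : nat) (A B : 'M[K]_n) :
  char_poly (A *m B) = char_poly (B *m A).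
Proof.
(* Both sides come from the determinant of the block matrix [[X, A], [B, 1]],
   after cancelling a factor det X. *)
rewrite /char_poly /char_poly_mx !map_mxM /=.
set a := map_mx _ A; set b := map_mx _ B; set X := 'X%:M.
have detAB : \det (block_mx X a b 1%:M) = \det (X - a *m b).
  have -> : \det (block_mx X a b 1%:M) =
      \det (block_mx X a b 1%:M *m block_mx 1%:M 0 (- b) 1%:M).
    by rewrite det_mulmx det_lblock !det1 !mulr1.
  rewrite mulmx_block !mulmx0 !mulmx1 !mul1mx mulmxN subrr !add0r.
  by rewrite det_ublock det1 mulr1.
have detBA : \det X * \det (block_mx X a b 1%:M) = \det X * \det (X - b *m a).
  have -> : \det X * \det (block_mx X a b 1%:M) =
      \det (block_mx 1%:M 0 (- b) X *m block_mx X a b 1%:M).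
    by rewrite det_mulmx det_lblock det1 mul1r.
  rewrite mulmx_block !mul0mx !mul1mx !addr0 mulmx1 mulNmx -scalar_mxC addNr.
  by rewrite det_ublock mulNmx [- _ + _]addrC.
apply: (@mulfI _ (\det X)); first by rewrite det_scalar expf_neq0 ?polyX_eq0.
by rewrite -detAB.
Qed.

(** The first [r] rows give column [j] a total weight [c j] in [0, 1], and these weights add up to
    [r]; the best choice puts full weight on the [r] largest values. *)
Lemma sum_doubly_stochastic_le (R : realDomainType) (n r : nat)
    (w : 'I_n -> 'I_n -> R) (g : 'I_n -> R) :
  (0 < r <= n)%N ->
  (forall i j, 0 <= w i j) -> (forall i, \sum_j w i j = 1) ->
  (forall j, \sum_i w i j = 1) ->
  (forall i j : 'I_n, (i <= j)%N -> g j <= g i) ->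
  \sum_(i < n | (i < r)%N) \sum_j w i j * g j <= \sum_(i < n | (i < r)%N) g i.
Proof.
case/andP; case: r => // r _ rn w0 wr wc gni.
(* [m] is the smallest of the values kept on the right. *)
pose m := g (Ordinal rn); rewrite exchange_big /=.
pose c j := \sum_(i < n | (i < r.+1)%N) w i j.
have c_ge0 j : 0 <= c j by apply: sumr_ge0.
have c_le1 j : c j <= 1.
  rewrite -(wc j) [leRHS](bigID (fun i : 'I_n => (i < r.+1)%N)) /= lerDl.
  exact: sumr_ge0.
have sum_c : \sum_j c j = \sum_(i < n | (i < r.+1)%N) 1.
  by rewrite exchange_big; apply: eq_bigr => i _; rewrite wr.
have -> : \sum_j \sum_(i < n | (i < r.+1)%N) w i j * g j
    = \sum_j c j * (g j - m) + \sum_(i < n | (i < r.+1)%N) m.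
  rewrite [X in _ + X](_ : _ = \sum_j c j * m); last first.
    by rewrite -mulr_suml sum_c mulr_suml; apply: eq_bigr => i _; rewrite mul1r.
  by rewrite -big_split; apply: eq_bigr => j _; rewrite -mulr_suml /c /=; ring.
(* The factor [g j - m] is nonnegative at kept indices, where [c j <= 1] is used, and nonpositive at
   the others, where [0 <= c j] is used. *)
rewrite -lerBrDr -sumrB big_mkcond [leRHS]big_mkcond; apply: ler_sum => j _.
case: ltnP => jr.
  by rewrite ler_piMl// subr_ge0 gni.
by rewrite mulr_ge0_le0// subr_le0 gni //= ltnW.
Qed.

(** * The scalar function g: convexity and monotonicity *)

Section Excess.
Variable R : realType.

Lemma le_ln_subr1 (x : R) : 0 < x -> ln x <= x - 1.
Proof.
by move=> x0; have := @le_ln1Dx R (x - 1); rewrite subrKC; apply; rewrite ltrBDr addNr.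
Qed.

Definition excess (x : R) : R := Num.max 1 x - ln (Num.max 1 x) - 1.

(** A supporting line of nonnegative slope yields both Jensen's inequality and monotonicity. *)
Lemma excess_tangent (a : R) :
  exists2 c, 0 <= c & forall x, excess a + c * (x - a) <= excess x.
Proof.
have max_gt0 y : 0 < Num.max 1 y :> R by rewrite lt_max ltr01.
(* The slope is the derivative of [excess] at [a]. *)
exists (1 - (Num.max 1 a)^-1) => [|x].
  by rewrite subr_ge0 invf_le1// le_max lexx.
rewrite /excess; set b := Num.max 1 a; set y := Num.max 1 x.
have b0 : 0 < b := max_gt0 a; have y0 : 0 < y := max_gt0 x.
have := le_ln_subr1 (divr_gt0 y0 b0).
rewrite ln_div ?posrE// => lnyb.
(* If [1 <= a] then [b = a] and [x <= y]; otherwise the slope is 0. *)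
have : (1 - b^-1) * (x - a) <= (1 - b^-1) * (y - b).
  rewrite /b; case: (leP 1 a) => a1.
    rewrite ler_wpM2l ?subr_ge0 ?invf_le1 ?(lt_le_trans ltr01)//.
    by rewrite lerD2r /y le_max lexx orbT.
  by rewrite invr1 subrr !mul0r.
have -> : (1 - b^-1) * (y - b) = y - b - y / b + 1 by field; rewrite gt_eqF.
by move: lnyb; lra.
Qed.

Lemma excess_jensen (I : finType) (w x : I -> R) :
  (forall i, 0 <= w i) -> \sum_i w i = 1 ->
  excess (\sum_i w i * x i) <= \sum_i w i * excess (x i).
Proof.
move=> w0 w1; set a := \sum_i _; have [c _ tangent] := excess_tangent a.
have -> : excess a = \sum_i w i * (excess a + c * (x i - a)).
  under eq_bigr do rewrite mulrDr [w _ * (c * _)]mulrCA [w _ * (_ - a)]mulrBr.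
  rewrite big_split /=.
  rewrite -mulr_suml w1 mul1r -mulr_sumr sumrB -mulr_suml w1 mul1r.
  by rewrite subrr mulr0 addr0.
by apply: ler_sum => i _; rewrite ler_wpM2l.
Qed.

Lemma excess_homo : {homo excess : x y / x <= y}.
Proof.
move=> x y xy; have [c c0 tangent] := excess_tangent x.
by apply: le_trans (tangent y); rewrite lerDl mulr_ge0// subr_ge0.
Qed.

End Excess.

(** * Unitary diagonalization and Rayleigh quotients *)

Section Unitary.
Local Open Scope sesquilinear_scope.
Variable C : numClosedFieldType.

(** The spectral theorem lists the eigenvalues in some order; unique factorization makes that list a
    permutation of [s], and permuting the rows of the unitary matrix restores the order of [s]. *)
Lemma hermitian_diag_of_char_poly (n : nat) (M : 'M[C]_n) (s : seq C) :
  M^t* = M -> char_poly M = \prod_(x <- s) ('X - x%:P) ->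
  exists2 Q : 'M[C]_n, Q \is unitarymx
    & M = Q^t* *m diag_mx (\row_i s`_i) *m Q.
Proof.
move=> Mherm Ms.
have /orthomx_spectralP ME : M \is normalmx by apply/normalmxP; rewrite Mherm.
have := spectral_unitarymx M.
set P := spectralmx M in ME *; set d := spectral_diag M in ME * => Punit.
rewrite invmx_unitary// in ME.
have /tuple_permP[p sE] : perm_eq s [tuple d 0 i | i < n].
  apply: prod_XsubC_eq; rewrite -Ms ME -mulmxA char_poly_mulC mulmxtVK//.
  rewrite char_poly_trig ?diag_mx_is_trig// big_map big_enum /=.
  by apply: eq_bigr => i _; rewrite mxE eqxx.
have s_nth (i : 'I_n) : s`_i = d 0 (p i).
  by rewrite sE -tnth_nth !tnth_mktuple.
exists (row_perm p P).
  by rewrite row_permE mul_unitarymx//; apply/unitarymxP;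
    rewrite tr_perm_mx map_perm_mx -perm_mxM mulgV perm_mx1.
rewrite ME; apply/matrixP => i j; rewrite !mul_mx_diag !mxE.
rewrite (reindex_perm p) /=; apply: eq_bigr => k _.
by rewrite !mxE s_nth.
Qed.

(** For unitary [U] and [Q] the weights form a doubly stochastic matrix, since [U *m Q^t*] is then
    unitary. *)
Lemma rayleigh_diag (n : nat) (U Q : 'M[C]_n) (d : 'rV[C]_n) (i : 'I_n) :
  (U *m (Q^t* *m diag_mx d *m Q) *m U^t*) i i =
  \sum_j `|(U *m Q^t*) i j| ^+ 2 * d 0 j.
Proof.
have -> : U *m (Q^t* *m diag_mx d *m Q) *m U^t* =
    (U *m Q^t*) *m diag_mx d *m (U *m Q^t*)^t*.
  by rewrite trmx_mul map_mxM trmxCK !mulmxA.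
set V := U *m _; rewrite mul_mx_diag mxE; apply: eq_bigr => j _.
by rewrite !mxE normCK mulrAC.
Qed.

Lemma unitary_row_norm (n : nat) (V : 'M[C]_n) (i : 'I_n) :
  V \is unitarymx -> \sum_j `|V i j| ^+ 2 = 1.
Proof.
move=> /unitarymxP/matrixP/(_ i i); rewrite !mxE eqxx mulr1n => <-.
by apply: eq_bigr => j _; rewrite !mxE normCK.
Qed.

Lemma unitary_col_norm (n : nat) (V : 'M[C]_n) (j : 'I_n) :
  V \is unitarymx -> \sum_i `|V i j| ^+ 2 = 1.
Proof.
rewrite -trmx_unitary => /unitary_row_norm-/(_ j) <-.
by apply: eq_bigr => i _; rewrite mxE.
Qed.

End Unitary.

(** * Hermitian matrices with a prescribed real spectrum *)

Section RealSpectrum.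
Local Open Scope sesquilinear_scope.
Local Open Scope complex_scope.
Variable R : realType.
Local Notation toC := (real_complex R).

Lemma nth_map_toC (s : seq R) (i : nat) : (map toC s)`_i = (s`_i)%:C.
Proof.
have [si|si] := ltnP i (size s); first by rewrite (nth_map 0).
by rewrite !nth_default ?size_map.
Qed.

Lemma hermitian_rayleigh_spectrum (n : nat) (M : 'M[R[i]]_n) (s : seq R) :
  M^t* = M -> char_poly M = \prod_(x <- s) ('X - (x%:C)%:P) ->
  exists2 U : 'M[R[i]]_n, U \is unitarymx
    & forall i : 'I_n, (U *m M *m U^t*) i i = (s`_i)%:C.
Proof.
move=> Mherm Ms.
have [|U Uunit ->] := @hermitian_diag_of_char_poly _ _ M (map toC s) Mherm.
  by rewrite big_map.
exists U => // i; rewrite !mulmxA mulmxtVK//.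
by rewrite (unitarymxP Uunit) mul1mx !mxE eqxx mulr1n nth_map_toC.
Qed.

(** Schur's majorization argument: Jensen in each row of [w], then the doubly stochastic bound, as
    [excess] is nonincreasing along the sorted [s]. *)
Lemma sum_excess_rayleigh_le (n r : nat) (M U : 'M[R[i]]_n) (s : seq R) :
  M^t* = M -> char_poly M = \prod_(x <- s) ('X - (x%:C)%:P) ->
  sorted >=%R s -> size s = n -> U \is unitarymx -> (0 < r <= n)%N ->
  \sum_(i < n | (i < r)%N) excess (complex.Re ((U *m M *m U^t*) i i)) <=
  \sum_(i < n | (i < r)%N) excess s`_i.
Proof.
move=> Mherm Ms s_sorted s_size Uunit rn.
have [|Q Qunit ->] := @hermitian_diag_of_char_poly _ _ M (map toC s) Mherm.
  by rewrite big_map.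
set V := U *m Q^t*; pose w i j : R := complex.Re (`|V i j| ^+ 2).
have Vunit : V \is unitarymx by rewrite mul_unitarymx ?trmxC_unitary.
have wE i j : (w i j)%:C = `|V i j| ^+ 2.
  by rewrite RRe_real// realX// normr_real.
have w_ge0 i j : 0 <= w i j by rewrite -lecR wE exprn_ge0.
have w_row i : \sum_j w i j = 1.
  apply: complexI; rewrite rmorph_sum [RHS]rmorph1 -(unitary_row_norm i Vunit).
  by apply: eq_bigr => j _; rewrite /= wE.
have w_col j : \sum_i w i j = 1.
  apply: complexI; rewrite rmorph_sum [RHS]rmorph1 -(unitary_col_norm j Vunit).
  by apply: eq_bigr => i _; rewrite /= wE.
have excess_s_homo (i j : 'I_n) : (i <= j)%N -> excess s`_j <= excess s`_i.
  move=> ij; apply: excess_homo.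
  by apply: (sorted_leq_nth ge_trans ge_refl) => //; rewrite inE s_size.
apply: le_trans (sum_doubly_stochastic_le rn w_ge0 w_row w_col excess_s_homo).
apply: ler_sum => i _; apply: le_trans (excess_jensen _ (w_ge0 i) (w_row i)).
suff -> : (U *m (Q^t* *m diag_mx (\row_j (map toC s)`_j) *m Q) *m U^t*) i i =
    (\sum_j w i j * s`_j)%:C by [].
rewrite rayleigh_diag rmorph_sum; apply: eq_bigr => j _.
by rewrite rmorphM /= wE mxE nth_map_toC.
Qed.

End RealSpectrum.

(** * Gram factors of semidefinite matrices, and convexity of [f2] and [f1] *)

Section ScaledSpectrum.
Local Open Scope sesquilinear_scope.
Local Open Scope complex_scope.
Variable R : realType.
Local Notation toC := (real_complex R).

Lemma conj_map_toC (m n : nat) (A : 'M[R]_(m, n)) :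
  (map_mx toC A)^t* = map_mx toC A^T.
Proof. by apply/matrixP => i j; rewrite !mxE conj_Creal//; apply/complex_realP; exists (A j i). Qed.

(** A real row eigenvector [v] for [x] satisfies v A v^T = x v v^T with v v^T > 0. *)
Lemma psd_eigvals_ge0 (n : nat) (A : 'M[R]_n) (i : nat) :
  A^T = A -> psd A -> 0 <= (eigvals A)`_i.
Proof.
move=> Asym Apsd; have [i_lt|i_ge] := ltnP i (size (eigvals A)); last first.
  (* Past the end of the list the default value is 0. *)
  by rewrite nth_default.
have : eigenvalue A (eigvals A)`_i.
  by rewrite eigenvalue_root_char sym_char_polyE// root_prod_XsubC mem_nth.
move: (_`_i) => x /eigenvalueP[v vA v0].
have vv_gt0 : 0 < (v *m v^T) 0 0.
  have sqr_ge0 j : true -> 0 <= v 0 j * v^T j 0 by rewrite mxE -expr2 sqr_ge0.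
  rewrite mxE lt_neqAle sumr_ge0// andbT eq_sym; apply: contraNN v0.
  rewrite psumr_eq0// => /allP vv0; apply/eqP/rowP => j; rewrite mxE.
  by have := vv0 j (mem_index_enum j); rewrite mxE mulf_eq0 orbb => /eqP.
have := Apsd v^T; rewrite trmxK vA -scalemxAl mxE.
by rewrite pmulr_lge0.
Qed.

(** Diagonalize and take square roots of the eigenvalues; [K] is complex because [Q] comes from the
    complex spectral theorem. *)
Lemma psd_gram (n : nat) (A : 'M[R]_n) : A^T = A -> psd A ->
  exists K : 'M[R[i]]_n, map_mx toC A = K^t* *m K.
Proof.
move=> Asym Apsd.
have [||Q _ AQ] := @hermitian_diag_of_char_poly _ _ (map_mx toC A) (map toC (eigvals A)).
- by rewrite conj_map_toC Asym.
- by rewrite -map_char_poly sym_char_polyE// map_prod_XsubC big_map.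
pose D := diag_mx (\row_i (Num.sqrt (eigvals A)`_i)) : 'M[R]_n.
exists (map_mx toC D *m Q).
rewrite trmx_mul map_mxM conj_map_toC tr_diag_mx !mulmxA -[_ *m _ *m map_mx _ _]mulmxA.
rewrite -map_mxM mulmx_diag AQ; congr (_ *m _ *m _).
rewrite map_diag_mx; congr diag_mx; apply/rowP => i.
by rewrite !mxE nth_map_toC -expr2 sqr_sqrtr ?psd_eigvals_ge0.
Qed.

Variables (p : nat) (S : 'M[R]_p).
Hypothesis Ssym : S^T = S.

Lemma scaled_sym (phi : 'rV[R]_p) : (scaled S phi)^T = scaled S phi.
Proof. by rewrite /scaled !trmx_mul tr_diag_mx Ssym mulmxA. Qed.

(** This trades a matrix involving square roots of [phi] for one linear in [phi]: with D D =
    diag(phi), the products K D D K^t* and D K^t* K D differ by a swap of two factors. *)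
Lemma char_poly_scaled (K : 'M[R[i]]_p) (phi : 'rV[R]_p) :
  map_mx toC S = K^t* *m K -> pos_orthant R p phi ->
  char_poly (K *m map_mx toC (diag_mx phi) *m K^t*) =
  \prod_(x <- eigvals (scaled S phi)) ('X - (x%:C)%:P).
Proof.
move=> SK phi_gt0.
rewrite -map_prod_XsubC -sym_char_polyE ?scaled_sym// map_char_poly.
rewrite /scaled !map_mxM /= SK.
set D := sqrt_diag phi.
have -> : diag_mx phi = D *m D.
  rewrite mulmx_diag; congr diag_mx; apply/rowP => i.
  by rewrite !mxE -expr2 sqr_sqrtr// ltW// phi_gt0.
by rewrite map_mxM -!mulmxA mulmxA char_poly_mulC !mulmxA.
Qed.

(** Summing over ['I_p] with the condition [i < r] matches the index type of the matrices. *)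
Lemma f2E (r : nat) (phi : 'rV[R]_p) : (r <= p)%N ->
  f2 r S phi = \sum_(i < p | (i < r)%N) excess (eigvals (scaled S phi))`_i.
Proof.
move=> rp; rewrite /f2 -sumrN.
rewrite -(big_ord_widen p (fun i => excess (eigvals (scaled S phi))`_i) rp).
by apply: eq_bigr => i _; rewrite /eigstar /excess; ring.
Qed.

Lemma f2_segment_le (r : nat) (a : R) (x y : 'rV[R]_p) :
  psd S -> (0 < r <= p)%N -> 0 <= a -> a <= 1 ->
  pos_orthant R p x -> pos_orthant R p y ->
  pos_orthant R p (a *: x + (1 - a) *: y) ->
  f2 r S (a *: x + (1 - a) *: y) <= a * f2 r S x + (1 - a) * f2 r S y.
Proof.
move=> Spsd rp a_ge0 a_le1 x_gt0 y_gt0; move zE: (_ *: x + _) => z z_gt0.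
have [K SK] := psd_gram Ssym Spsd.
pose M (phi : 'rV[R]_p) := K *m map_mx toC (diag_mx phi) *m K^t*.
have Mherm phi : (M phi)^t* = M phi.
  by rewrite /M !trmx_mul !map_mxM trmxCK conj_map_toC tr_diag_mx mulmxA.
have Mchar phi := @char_poly_scaled K phi SK.
have MzE : M z = toC a *: M x + toC (1 - a) *: M y.
  rewrite /M -zE linearD /= !linearZ /= map_mxD !map_mxZ.
  by rewrite mulmxDr mulmxDl -!scalemxAr -!scalemxAl.
(* The eigenbasis of [M z] is kept fixed and also tested against [M x] and [M y]. *)
have [U Uunit Uz] := hermitian_rayleigh_spectrum (Mherm z) (Mchar z z_gt0).
have bound phi : pos_orthant R p phi ->
    \sum_(i < p | (i < r)%N) excess (complex.Re ((U *m M phi *m U^t*) i i)) <=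
    f2 r S phi.
  move=> phi_gt0; rewrite f2E; last by case/andP: rp.
  apply: sum_excess_rayleigh_le => //; first exact: Mchar.
    exact: eigvals_sorted.
  by rewrite size_eigvals// scaled_sym.
have Re_segment (A B : 'M[R[i]]_p) i : complex.Re ((toC a *: A + toC (1 - a) *: B) i i) =
    a * complex.Re (A i i) + (1 - a) * complex.Re (B i i).
  by rewrite !mxE; case: (A i i) (B i i) => [? ?] [? ?] /=; ring.
pose q (phi : 'rV[R]_p) (i : 'I_p) := complex.Re ((U *m M phi *m U^t*) i i).
suff f2z : f2 r S z <= a * (\sum_(i < p | (i < r)%N) excess (q x i)) +
    (1 - a) * (\sum_(i < p | (i < r)%N) excess (q y i)).
  apply: (le_trans f2z); apply: lerD; apply: ler_wpM2l; rewrite ?subr_ge0//.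
    exact: bound.
  exact: bound.
rewrite f2E; last by case/andP: rp.
rewrite [X in _ <= X + _]mulr_sumr [X in _ <= _ + X]mulr_sumr -big_split.
apply: ler_sum => i _ /=.
set u := q x i; set v := q y i.
have -> : (eigvals (scaled S z))`_i = a * u + (1 - a) * v.
  have := congr1 (@complex.Re R) (Uz i); rewrite /= => <-.
  rewrite MzE mulmxDr mulmxDl -!scalemxAr -!scalemxAl.
  exact: Re_segment.
(* Two-point Jensen, with [bool] as the index type. *)
pose w (b : bool) := if b then a else 1 - a.
have := @excess_jensen R bool w (fun b => if b then u else v).
rewrite !big_bool /=; apply; first by case; rewrite /= ?subr_ge0.
by rewrite addrC subrK.
Qed.

Lemma convex_f2 (r : nat) : psd S -> (0 < r <= p)%N ->
  convex_function (pos_orthant R p) (f2 r S).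
Proof.
move=> Spsd rp t x y; rewrite !inE => x_gt0 y_gt0.
apply: f2_segment_le => // i; rewrite !mxE.
exact: convR_gt0 (x_gt0 i) (y_gt0 i).
Qed.

(** Termwise: [ln] is concave and the remaining part is linear. *)
Lemma convex_f1 : convex_function (pos_orthant R p) (f1 S).
Proof.
move=> t x y; rewrite !inE => x_gt0 y_gt0.
rewrite /f1 convRE !mulr_sumr -big_split; apply: ler_sum => i _ /=.
have := concave_ln t (x_gt0 i) (y_gt0 i); rewrite !convRE => ln_le.
rewrite !mxE.
move: ln_le; rewrite /unstable.onem; lra.
Qed.

End ScaledSpectrum.

Theorem corollary3 (R : realType) (p r : nat) (S : 'M[R]_p)
    (hp : (1 <= p)%N) (hr : (1 <= r <= p)%N)
    (Ssym : S^T = S) (Spsd : psd S) (Sdiag : forall i, 0 < S i i) :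
  (forall phi, pos_orthant R p phi -> f r S phi = f1 S phi - f2 r S phi) /\
  convex_function (pos_orthant R p) (f1 S) /\
  convex_function (pos_orthant R p) (f2 r S).
Proof.
split; first by move=> phi _; rewrite /f /f1 /f2 opprK.
split; [exact: convex_f1 | exact: convex_f2].
Qed.
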